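(* Let $(U,E)$ be a univalent universe, $\mathcal{A}$ a reflexive graph, and $\mathcal{B}$ an oplax covariant lens of $U$-small path objects over $\mathcal{A}$, with pushforward $\mathsf{push}$ and unitor $\mathsf{pushRx}$. Let $\mathcal{B}'$ be the oplax covariant lens defined below and $\eta$ the family of equivalences of reflexive graphs $\eta_x:\mathcal{B}(x)\simeq\mathcal{B}'(x)$ defined below. Then $\eta$ extends to an equivalence of oplax covariant lenses from $\mathcal{B}$ to $\mathcal{B}'$ (in the sense below) whose underlying family of equivalences of reflexive graphs is $\eta$.
   Context: Intensional Martin-Löf type theory with $\Pi,\Sigma$, identity types. A reflexive graph $\mathcal{G}$: vertex type $|\mathcal{G}|$, edge types $x\approx_{\mathcal{G}}y$, $\mathsf{rx}_{\mathcal{G}}(x):x\approx_{\mathcal{G}}x$; it is a path object if each fan $\sum_y x\approx_{\mathcal{G}}y$ is a proposition; then edges can be concatenated ($p\cdot q$, obtained from concatenation of identifications via the equivalence $(x=y)\simeq(x\approx y)$ sending $\mathsf{refl}$ to $\mathsf{rx}$), with $p\cdot\mathsf{rx}=p$. An oplax covariant lens $\mathcal{C}$ over $\mathcal{A}$: family of reflexive graphs $\mathcal{C}(x)$ ($x:|\mathcal{A}|$), $\mathsf{push}^{\mathcal{C}}_p:|\mathcal{C}(x)|\to|\mathcal{C}(y)|$ for $p:x\approx_{\mathcal{A}}y$, and $\mathsf{pushRx}^{\mathcal{C}}_x(u):\mathsf{push}^{\mathcal{C}}_{\mathsf{rx}_{\mathcal{A}}(x)}u\approx_{\mathcal{C}(x)}u$.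 Definition of $\mathcal{B}'$: $|\mathcal{B}'(x)|:=|\mathcal{B}(x)|$, $u\approx_{\mathcal{B}'(x)}v:=\mathsf{push}_{\mathsf{rx}_{\mathcal{A}}(x)}u\approx_{\mathcal{B}(x)}v$, $\mathsf{rx}_{\mathcal{B}'(x)}(u):=\mathsf{pushRx}_x(u)$; $\mathsf{push}^{\mathcal{B}'}_pu:=\mathsf{push}_pu$; and $\mathsf{pushRx}^{\mathcal{B}'}_x(u):=\mathsf{str}_{\mathsf{rx}_{\mathcal{A}}(x)}(\mathsf{pushRx}_x(u))$, where for $p:x\approx_{\mathcal{A}}y$, $u:|\mathcal{B}(x)|$, $v:|\mathcal{B}(y)|$ and $q:\mathsf{push}_pu\approx_{\mathcal{B}(y)}v$, $\mathsf{str}_p(q):\mathsf{push}_{\mathsf{rx}_{\mathcal{A}}(y)}(\mathsf{push}_pu)\approx_{\mathcal{B}(y)}v$ is the transport of $\mathsf{pushRx}_y(\mathsf{push}_pu)$ along an identification $(\mathsf{push}_pu,\mathsf{rx}_{\mathcal{B}(y)}(\mathsf{push}_pu))=(v,q)$ in the contractible type $\sum_w\mathsf{push}_pu\approx_{\mathcal{B}(y)}w$, in the family $(w,r)\mapsto\mathsf{push}_{\mathsf{rx}(y)}(\mathsf{push}_pu)\approx_{\mathcal{B}(y)}w$. Definition of $\eta_x$: identity on vertices; on edges $q:u\approx_{\mathcal{B}(x)}v\mapsto\mathsf{pushRx}_x(u)\cdot q$ (an equivalence); reflexivity preserved via $\mathsf{pushRx}_x(u)\cdot\mathsf{rx}=\mathsf{pushRx}_x(u)$.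 An equivalence of reflexive graphs $f:\mathcal{G}\simeq\mathcal{H}$: an equivalence $|f|:|\mathcal{G}|\simeq|\mathcal{H}|$, equivalences $f^{\approx}:(x\approx_{\mathcal{G}}y)\simeq(|f|x\approx_{\mathcal{H}}|f|y)$, and identifications $f^{\approx}(\mathsf{rx}(x))=\mathsf{rx}(|f|x)$. An equivalence of oplax covariant lenses $\mathcal{C}_0\to\mathcal{C}_1$ over $\mathcal{A}$ (with $U$-small components) consists of: equivalences of reflexive graphs $f_x:\mathcal{C}_0(x)\simeq\mathcal{C}_1(x)$; an identification $H$ in $\prod_{x,y}\prod_{p:x\approx y}|\mathcal{C}_0(x)|\to|\mathcal{C}_1(y)|$ between $\Phi_0:=\lambda x,y,p,u.\,|f_y|(\mathsf{push}^{\mathcal{C}_0}_pu)$ and $\Phi_1:=\lambda x,y,p,u.\,\mathsf{push}^{\mathcal{C}_1}_p(|f_x|u)$; and an identification between the transport along $H$, in the family $\Phi\mapsto\prod_x\prod_{u:|\mathcal{C}_0(x)|}\Phi\,x\,x\,(\mathsf{rx}_{\mathcal{A}}(x))\,u\approx_{\mathcal{C}_1(x)}|f_x|u$, of $\lambda x,u.\,f_x^{\approx}(\mathsf{pushRx}^{\mathcal{C}_0}_x(u))$ and $\lambda x,u.\,\mathsf{pushRx}^{\mathcal{C}_1}_x(|f_x|u)$. $(U,E)$ univalent universe: $(A=_UB)\to\mathsf{Equiv}(EA,EB)$ is an equivalence. *)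

(* Defs.v *)
(* Plain Rocq, no library beyond the prelude.  Identity types are taken in
   [Type] rather than using the [Prop]-valued [eq]. *)

Inductive Id {A : Type} (a : A) : A -> Type :=
  refl : Id a a.

Arguments refl {A a}.

Definition inv {A : Type} {a b : A} (p : Id a b) : Id b a :=
  match p in Id _ c return Id c a with refl => refl end.

Definition cat {A : Type} {a b c : A} (p : Id a b) (q : Id b c) : Id a c :=
  match q in Id _ d return Id a d with refl => p end.

Definition ap {A B : Type} (f : A -> B) {a b : A} (p : Id a b) :
    Id (f a) (f b) :=
  match p in Id _ c return Id (f a) (f c) with refl => refl end.

Definition transport {A : Type} (P : A -> Type) {a b : A} (p : Id a b) :
    P a -> P b :=
  match p in Id _ c return P a -> P c with refl => fun x => x end.

Definition isProp (A : Type) : Type := forall a b : A, Id a b.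

Definition isContr (A : Type) : Type := {c : A & forall a : A, Id c a}.

Definition fiber {A B : Type} (f : A -> B) (b : B) : Type :=
  {a : A & Id (f a) b}.

Definition isEquiv {A B : Type} (f : A -> B) : Type :=
  forall b : B, isContr (fiber f b).

Record Equiv (A B : Type) : Type := MkEquiv {
  equiv_fun :> A -> B;
  equiv_isEquiv : isEquiv equiv_fun
}.

Arguments MkEquiv {A B} equiv_fun equiv_isEquiv.
Arguments equiv_fun {A B} e _.
Arguments equiv_isEquiv {A B} e _.

Definition invEquiv {A B : Type} {f : A -> B} (H : isEquiv f) (b : B) : A :=
  projT1 (projT1 (H b)).

Definition invEquiv_sec {A B : Type} {f : A -> B} (H : isEquiv f) (b : B) :
    Id (f (invEquiv H b)) b :=
  projT2 (projT1 (H b)).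

Definition invEquiv_ret {A B : Type} {f : A -> B} (H : isEquiv f) (a : A) :
    Id (invEquiv H (f a)) a :=
  ap (@projT1 _ _) (projT2 (H (f a)) (existT _ a refl)).

Lemma inv_cat {A : Type} {a b : A} (p : Id a b) : Id (cat (inv p) p) refl.
Proof. destruct p; exact refl. Defined.

Lemma cat_inv {A : Type} {a b c : A} (p : Id a b) (q : Id a c) :
  Id (cat p (inv (cat (inv q) p))) q.
Proof. destruct p, q; exact refl. Defined.

Lemma isContr_retract {A B : Type} (s : A -> B) (r : B -> A)
    (h : forall a, Id (r (s a)) a) : isContr B -> isContr A.
Proof.
intros [c hc]; exists (r c); intro a.
exact (cat (ap r (hc (s a))) (h a)).
Defined.

Lemma isEquiv_of_inverse {A B : Type} (f : A -> B) (g : B -> A)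
    (s : forall b, Id (f (g b)) b) (r : forall a, Id (g (f a)) a) :
  isEquiv f.
Proof.
intro b.
apply (@isContr_retract _ (fiber (fun b' => f (g b')) b)
  (fun w => existT _ (f (projT1 w)) (cat (ap f (r (projT1 w))) (projT2 w)))
  (fun w => existT _ (g (projT1 w)) (projT2 w))).
- intros [a p]; destruct p; simpl.
  generalize (r a); generalize (g (f a)); intros a' e; destruct e; exact refl.
- apply (@isContr_retract _ {b' : B & Id b b'}
    (fun w => existT _ (projT1 w) (cat (inv (projT2 w)) (s (projT1 w))))
    (fun w => existT _ (projT1 w) (cat (s (projT1 w)) (inv (projT2 w))))).
  + intros [b' p]; exact (ap (existT _ b') (cat_inv (s b') p)).
  + exists (existT _ b refl); intros [b' p]; destruct p; exact refl.
Defined.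

Definition idEquiv (A : Type) : Equiv A A :=
  MkEquiv (fun a => a)
    (isEquiv_of_inverse _ (fun a => a) (fun _ => refl) (fun _ => refl)).

(** * Univalent universes *)

Definition idToEquiv {U : Type} (E : U -> Type) {a b : U} (p : Id a b) :
    Equiv (E a) (E b) :=
  match p in Id _ c return Equiv (E a) (E c) with refl => idEquiv (E a) end.

Definition isUnivalent (U : Type) (E : U -> Type) : Type :=
  forall a b : U, isEquiv (@idToEquiv U E a b).

(** * Reflexive graphs *)

Record RGraph : Type := MkRGraph {
  vert : Type;
  edge : vert -> vert -> Type;
  rx : forall x : vert, edge x x
}.

Arguments edge {r} _ _.
Arguments rx {r} _.

Definition fan {G : RGraph} (x : vert G) : Type := {y : vert G & edge x y}.

Definition isPathObject (G : RGraph) : Type :=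
  forall x : vert G, isProp (fan x).

Definition idToEdge {G : RGraph} {x y : vert G} (p : Id x y) : edge x y :=
  match p in Id _ z return edge x z with refl => rx x end.

Lemma edge_ind {G : RGraph} (HG : isPathObject G) {x : vert G}
    (P : forall y, edge x y -> Type) (h : P x (rx x))
    (y : vert G) (p : edge x y) : P y p.
Proof.
exact (transport (fun w => P (projT1 w) (projT2 w))
  (HG x (existT _ x (rx x)) (existT _ y p)) h).
Defined.

Lemma idToEdge_isEquiv {G : RGraph} (HG : isPathObject G) (x y : vert G) :
  isEquiv (@idToEdge G x y).
Proof.
pose (c := existT _ x (rx x) : fan x).
(* The base point is normalised so that [rx x] is sent to [refl]. *)
pose (g := fun (z : vert G) (p : edge x z) =>
  ap (@projT1 _ _) (cat (inv (HG x c c)) (HG x c (existT _ z p))) : Id x z).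
assert (g_rx : Id (g x (rx x)) refl)
  by exact (ap (ap (@projT1 _ _)) (inv_cat (HG x c c))).
apply (isEquiv_of_inverse _ (g y)).
- intro p; revert y p; apply (edge_ind HG).
  exact (ap idToEdge g_rx).
- intro p; destruct p; exact g_rx.
Defined.

Definition edgeToId {G : RGraph} (HG : isPathObject G) {x y : vert G} :
    edge x y -> Id x y :=
  invEquiv (idToEdge_isEquiv HG x y).

Definition concat {G : RGraph} (HG : isPathObject G) {x y z : vert G}
    (p : edge x y) (q : edge y z) : edge x z :=
  idToEdge (cat (edgeToId HG p) (edgeToId HG q)).

Lemma edgeToId_rx {G : RGraph} (HG : isPathObject G) (x : vert G) :
  Id (edgeToId HG (rx x)) refl.
Proof. exact (invEquiv_ret (idToEdge_isEquiv HG x x) refl). Defined.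

Lemma concat_rx {G : RGraph} (HG : isPathObject G) {x y : vert G}
    (p : edge x y) : Id (concat HG p (rx y)) p.
Proof.
exact (cat (ap (fun e => idToEdge (cat (edgeToId HG p) e)) (edgeToId_rx HG y))
  (invEquiv_sec (idToEdge_isEquiv HG x y) p)).
Defined.

Lemma rx_concat {G : RGraph} (HG : isPathObject G) {x y : vert G}
    (q : edge x y) : Id (concat HG (rx x) q) q.
Proof.
revert y q; apply (edge_ind HG); apply concat_rx.
Defined.

Lemma concat_isEquiv {G : RGraph} (HG : isPathObject G) {x y : vert G}
    (p : edge x y) (z : vert G) :
  isEquiv (fun q : edge y z => concat HG p q).
Proof.
revert y p; apply (edge_ind HG).
exact (isEquiv_of_inverse _ (fun q => q) (rx_concat HG) (rx_concat HG)).
Defined.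

Record RGEquiv (G H : RGraph) : Type := MkRGEquiv {
  rge_vert : Equiv (vert G) (vert H);
  rge_edge : forall x y : vert G,
    Equiv (edge x y) (edge (rge_vert x) (rge_vert y));
  rge_rx : forall x : vert G, Id (rge_edge x x (rx x)) (rx (rge_vert x))
}.

Arguments MkRGEquiv {G H} rge_vert rge_edge rge_rx.
Arguments rge_vert {G H} r.
Arguments rge_edge {G H} r {x y}.
Arguments rge_rx {G H} r x.

(** * Reflexive graphs and oplax covariant lenses with [U]-small components *)

Record SmallRGraph (U : Type) (E : U -> Type) : Type := MkSmallRGraph {
  vcode : U;
  ecode : E vcode -> E vcode -> U;
  srx : forall x : E vcode, E (ecode x x)
}.

Arguments MkSmallRGraph {U E} vcode ecode srx.
Arguments vcode {U E} s.
Arguments ecode {U E} s _ _.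
Arguments srx {U E} s x.

Definition decode {U : Type} {E : U -> Type} (G : SmallRGraph U E) : RGraph :=
  MkRGraph (E (vcode G)) (fun x y => E (ecode G x y)) (srx G).

Coercion decode : SmallRGraph >-> RGraph.

Record OplaxLens (U : Type) (E : U -> Type) (A : RGraph) : Type := MkOplaxLens {
  comp :> vert A -> SmallRGraph U E;
  push : forall x y : vert A, edge x y -> vert (comp x) -> vert (comp y);
  pushRx : forall (x : vert A) (u : vert (comp x)),
    @edge (comp x) (push x x (rx x) u) u
}.

Arguments MkOplaxLens {U E A} comp push pushRx.
Arguments comp {U E A} o x.
Arguments push {U E A} o {x y} p u.
Arguments pushRx {U E A} o x u.

Record LensEquiv {U : Type} {E : U -> Type} {A : RGraph}
    (C0 C1 : OplaxLens U E A) : Type := MkLensEquiv {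
  le_fam : forall x : vert A, RGEquiv (C0 x) (C1 x);
  le_push :
    @Id (forall x y : vert A, edge x y -> vert (C0 x) -> vert (C1 y))
      (fun x y p u => rge_vert (le_fam y) (push C0 p u))
      (fun x y p u => push C1 p (rge_vert (le_fam x) u));
  le_pushRx :
    Id
      (transport
        (fun Phi : forall x y : vert A, edge x y -> vert (C0 x) -> vert (C1 y) =>
          forall (x : vert A) (u : vert (C0 x)),
            @edge (C1 x) (Phi x x (rx x) u) (rge_vert (le_fam x) u))
        le_push
        (fun x u => rge_edge (le_fam x) (pushRx C0 x u)))
      (fun x u => pushRx C1 x (rge_vert (le_fam x) u))
}.

Arguments MkLensEquiv {U E A C0 C1} le_fam le_push le_pushRx.
Arguments le_fam {U E A C0 C1} l x.
Arguments le_push {U E A C0 C1} l.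
Arguments le_pushRx {U E A C0 C1} l.

(** * The lens [B'] and the family [eta] *)

(* The identification in the fan of [push p u] is the one given by the
   hypothesis that the components are path objects; as that hypothesis is an
   arbitrary witness, so is this identification. *)
Definition str {U : Type} {E : U -> Type} {A : RGraph} (B : OplaxLens U E A)
    (HB : forall x, isPathObject (B x)) {x y : vert A} (p : edge x y)
    {u : vert (B x)} {v : vert (B y)} (q : @edge (B y) (push B p u) v) :
    @edge (B y) (push B (rx y) (push B p u)) v :=
  transport
    (fun w : @fan (B y) (push B p u) =>
      @edge (B y) (push B (rx y) (push B p u)) (projT1 w))
    (HB y (push B p u) (existT _ (push B p u) (rx (push B p u))) (existT _ v q))
    (pushRx B y (push B p u)).

Definition lens' {U : Type} {E : U -> Type} {A : RGraph} (B : OplaxLens U E A)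
    (HB : forall x, isPathObject (B x)) : OplaxLens U E A :=
  MkOplaxLens
    (fun x => MkSmallRGraph (vcode (B x))
      (fun u v => ecode (B x) (push B (rx x) u) v)
      (fun u => pushRx B x u))
    (fun x y p u => push B p u)
    (fun x u => str B HB (rx x) (pushRx B x u)).

Definition eta {U : Type} {E : U -> Type} {A : RGraph} (B : OplaxLens U E A)
    (HB : forall x, isPathObject (B x)) (x : vert A) :
    RGEquiv (B x) (lens' B HB x) :=
  @MkRGEquiv (B x) (lens' B HB x)
    (idEquiv (vert (B x)))
    (fun u v => MkEquiv
      (fun q : @edge (B x) u v => concat (HB x) (pushRx B x u) q)
      (concat_isEquiv (HB x) (pushRx B x u) v))
    (fun u => concat_rx (HB x) (pushRx B x u)).

(* Main.v *)
From Stdlib Require Import FunctionalExtensionality.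
Require Import Defs.

(** Since [eta] is the identity on vertices and [lens'] keeps [push], the two pushforward composites
    agree judgmentally. What remains is that prefixing [pushRx] by [concat] agrees pointwise with
    [str] ([concat_eq_str]); induction on the fan identification reduces this to [concat_rx]. *)

Lemma Id_of_eq {A : Type} {a b : A} (p : a = b) : Id a b.
Proof. destruct p; exact refl. Defined.

Lemma eq_of_Id {A : Type} {a b : A} (p : Id a b) : a = b.
Proof. destruct p; exact eq_refl. Defined.

(* Univalence of [(U, E)] only concerns [U]-small types, whereas the vertices of
   the base graph form an arbitrary type; hence the axiom. *)
Lemma Id_funext {A : Type} {P : A -> Type} (f g : forall a, P a) :
  (forall a, Id (f a) (g a)) -> Id f g.
Proof.
intro h; apply Id_of_eq, functional_extensionality_dep.
intro a; exact (eq_of_Id (h a)).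
Defined.

(** With [w] and [p] free, path induction applies whichever identification the path-object witness
    supplies. *)
Lemma concat_eq_transport {G : RGraph} (HG : isPathObject G) {a x : vert G}
    (e : edge a x) (w : fan x) (p : Id (existT _ x (rx x)) w) :
  Id (concat HG e (projT2 w))
     (transport (fun w : fan x => edge a (projT1 w)) p e).
Proof. destruct p; exact (concat_rx HG e). Defined.

Lemma concat_eq_str {U : Type} {E : U -> Type} {A : RGraph}
    (B : OplaxLens U E A) (HB : forall x, isPathObject (B x))
    {x y : vert A} (p : edge x y) {u : vert (B x)} {v : vert (B y)}
    (q : @edge (B y) (push B p u) v) :
  Id (concat (HB y) (pushRx B y (push B p u)) q) (str B HB p q).
Proof.
exact (concat_eq_transport (HB y) (pushRx B y (push B p u)) (existT _ v q) _).
Defined.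

Theorem mainTheorem3 (U : Type) (E : U -> Type) (HU : isUnivalent U E)
    (A : RGraph) (B : OplaxLens U E A) (HB : forall x : vert A, isPathObject (B x)) :
  {e : LensEquiv B (lens' B HB) & Id (le_fam e) (eta B HB)}.
Proof.
unshelve eexists.
- apply (@MkLensEquiv _ _ _ B (lens' B HB) (eta B HB) refl).
  (* Transport along [refl] computes away, so the two unitors are compared directly. *)
  apply Id_funext; intro x; apply Id_funext; intro u.
  exact (concat_eq_str B HB (rx x) (pushRx B x u)).
- exact refl.
Qed.
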